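(* Let $\mathcal{G}_t$ be the extended graph of the structural model $[A],[B],[C]$, let $\mathcal{U}_a\subseteq\mathcal{U}$ and $\mathcal{Y}_a\subseteq\mathcal{Y}$ be the attacked actuators and (unprotected) attacked sensors, respectively, let $u_i\in\mathcal{U}_a$, and let $$\mathcal{X}_a=\{x_j\in\mathcal{X}: (u_k,x_j)\in\mathcal{E}_{ux},\ u_k\in\mathcal{U}_a\setminus\{u_i\}\}.$$ If $\mathcal{X}_a\cup\mathcal{Y}_a$ is a vertex separator of $u_i$ and $t$ in $\mathcal{G}_t$, then $$\delta(u_i)\le|\mathcal{U}_a|+|\mathcal{Y}_a|$$ for any realization of matrices $A,B,C$.
   Context: System and security index. For real matrices $A\in\mathbb{R}^{n_x\times n_x}$, $B\in\mathbb{R}^{n_x\times n_u}$, $C\in\mathbb{R}^{(n_y+n_e)\times n_x}$, consider, for $k\in\mathbb{Z}_{\ge0}$, $x(k+1)=Ax(k)+B_a a(k)$, $y(k)=Cx(k)+D_a a(k)$, $x(0)=0$ (control input zero), where $$B_a=\begin{bmatrix} B & \mathbf{0}_{n_x\times n_y}\end{bmatrix},\qquad D_a=\begin{bmatrix}\mathbf{0}_{n_y\times n_u} & \mathbf{I}_{n_y}\\ \mathbf{0}_{n_e\times n_u} & \mathbf{0}_{n_e\times n_y}\end{bmatrix}.$$ The first $n_u$ entries of the attack $a(k)\in\mathbb{R}^{n_u+n_y}$ act on the actuators $u_1,\dots,u_{n_u}$ and the last $n_y$ on the unprotected sensors $y_1,\dots,y_{n_y}$; sensors $y_{n_y+1},\dots,y_{n_y+n_e}$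 are protected and cannot be attacked. $\delta(u_i)$ is the minimum, over signals $a:\mathbb{Z}_{\ge0}\to\mathbb{R}^{n_u+n_y}$ with $y(k)=0$ for all $k$ and with the $i$-th entry $a^{(u_i)}(k)\ne0$ for at least one $k$, of $\|a\|_0$, the number of entries of $a$ that are nonzero at some time; $\delta(u_i)=+\infty$ if no such $a$ exists. Structural model. $[A],[B],[C]$ are binary matrices of the same sizes as $A,B,C$. A realization is a triple of real matrices $A,B,C$ whose entries are $0$ wherever the corresponding structural entry is $0$, and arbitrary real numbers where it is $1$, subject to the following standing assumption (with $e_i$ canonical basis vectors): (1) $[B]=[e_{i_1}\ \cdots\ e_{i_{n_u}}]$; (2) $[B]$ has full column rank; (3) if $[B](i,j)=1$ then $B(i,j)\neq0$ in every realization; (4) $[C]=[e_{j_1}\ \cdots\ e_{j_{n_y+n_e}}]^T$. Graph. $\mathcal{X}=\{x_1,\dots,x_{n_x}\}$, $\mathcal{U}=\{u_1,\dots,u_{n_u}\}$, $\mathcal{Y}=\{y_1,\dots,y_{n_y+n_e}\}$ (states, actuators, sensors). $\mathcal{E}_{ux}=\{(u_j,x_i):[B](i,j)\ne0\}$, $\mathcal{E}_{xx}=\{(x_j,x_i):[A](i,j)\neq0\}$, $\mathcal{E}_{xy}=\{(x_j,y_i):[C](i,j)\ne0\}$. The extended graph $\mathcal{G}_t$ is the directed graph with nodes $\mathcal{X}\cup\mathcal{U}\cup\mathcal{Y}\cup\{t\}$ and edges $\mathcal{E}_{ux}\cup\mathcal{E}_{xx}\cup\mathcal{E}_{xy}\cup\{(y_i,t):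 y_i\in\mathcal{Y}\}$. A vertex separator of non-adjacent nodes $v_a,v_b$ is a set of nodes not containing $v_a,v_b$ whose removal deletes all directed paths from $v_a$ to $v_b$. *)

(* Defs.v *)
From HB Require Import structures.
From mathcomp Require Import all_boot all_order all_algebra.
From mathcomp Require Import boolp reals constructive_ereal.

Set Implicit Arguments.
Unset Strict Implicit.
Unset Printing Implicit Defensive.

Import Order.TTheory GRing.Theory Num.Theory.

Local Open Scope ring_scope.

Section System.
Variables (R : realType) (nx nu ny ne : nat).
Variables (A : 'M[R]_nx) (B : 'M[R]_(nx, nu)) (C : 'M[R]_(ny + ne, nx)).

(* Attack entries [lshift ny j] act on actuator [j] and [rshift nu j] on sensor
   [lshift ne j]; the last [ne] sensors are protected. *)
Definition attack_signal := nat -> 'cV[R]_(nu + ny).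

Definition attack_input_mx : 'M[R]_(nx, nu + ny) := row_mx B 0.

Definition attack_output_mx : 'M[R]_(ny + ne, nu + ny) :=
  block_mx 0 1%:M 0 0.

Fixpoint state (a : attack_signal) (k : nat) : 'cV[R]_nx :=
  if k is k'.+1 then A *m state a k' + attack_input_mx *m a k' else 0.

Definition output (a : attack_signal) (k : nat) : 'cV[R]_(ny + ne) :=
  C *m state a k + attack_output_mx *m a k.

Definition attack_norm0 (a : attack_signal) : nat :=
  #|[pred j | `[< exists k, a k j ord0 != 0 >]]|.

Definition undetectable_using (i : 'I_nu) (a : attack_signal) : Prop :=
  (forall k, output a k = 0) /\ (exists k, a k (lshift ny i) ord0 != 0).

Definition attack_size (i : 'I_nu) : pred nat :=
  fun s => `[< exists a, undetectable_using i a /\ attack_norm0 a = s >].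

Definition security_index (i : 'I_nu) : \bar R :=
  if pselect (exists s, attack_size i s) is left ex_s
  then (ex_minn ex_s)%:R%:E else +oo%E.

End System.

Section Structure.
Variables (R : realType) (nx nu ny ne : nat).

Definition mx01 (m n : nat) (S : 'M[bool]_(m, n)) : 'M[R]_(m, n) :=
  map_mx (fun b : bool => b%:R) S.

(* The rank of the binary matrix [Bs] is taken over the reals. *)
Definition structural_model
    (Bs : 'M[bool]_(nx, nu)) (Cs : 'M[bool]_(ny + ne, nx)) : Prop :=
  [/\ exists b : 'I_nu -> 'I_nx,
        forall j, col j (mx01 Bs) = delta_mx (b j) ord0,
      \rank (mx01 Bs) = nu &
      exists c : 'I_(ny + ne) -> 'I_nx,
        forall i, row i (mx01 Cs) = delta_mx ord0 (c i)].

Definition has_structure (m n : nat)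
    (S : 'M[bool]_(m, n)) (M : 'M[R]_(m, n)) : Prop :=
  forall i j, S i j = false -> M i j = 0.

(* Structural ones of [As] and [Cs] may be realized by 0, those of [Bs] may
   not. *)
Definition realization
    (As : 'M[bool]_nx) (Bs : 'M[bool]_(nx, nu)) (Cs : 'M[bool]_(ny + ne, nx))
    (A : 'M[R]_nx) (B : 'M[R]_(nx, nu)) (C : 'M[R]_(ny + ne, nx)) : Prop :=
  [/\ has_structure As A, has_structure Bs B, has_structure Cs C &
      forall i j, Bs i j -> B i j != 0].

End Structure.

Inductive node (nx nu m : nat) : Type :=
  | NX of 'I_nx
  | NU of 'I_nu
  | NY of 'I_m
  | NT.

Arguments NX {nx nu m} _.
Arguments NU {nx nu m} _.
Arguments NY {nx nu m} _.
Arguments NT {nx nu m}.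

Section NodeFinType.
Variables (nx nu m : nat).

Definition node_encode (v : node nx nu m) : 'I_nx + 'I_nu + 'I_m + unit :=
  match v with
  | NX x => inl (inl (inl x))
  | NU u => inl (inl (inr u))
  | NY y => inl (inr y)
  | NT => inr tt
  end.

Definition node_decode (c : 'I_nx + 'I_nu + 'I_m + unit) : node nx nu m :=
  match c with
  | inl (inl (inl x)) => NX x
  | inl (inl (inr u)) => NU u
  | inl (inr y) => NY y
  | inr _ => NT
  end.

Lemma node_encodeK : cancel node_encode node_decode.
Proof. by case. Qed.

HB.instance Definition _ := Finite.copy (node nx nu m) (can_type node_encodeK).

End NodeFinType.

(* The structural matrices carry the head of an edge as row index and its tail
   as column index. *)
Definition extended_graph (nx nu m : nat) (As : 'M[bool]_nx)
    (Bs : 'M[bool]_(nx, nu)) (Cs : 'M[bool]_(m, nx)) : rel (node nx nu m) :=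
  fun v w =>
    match v, w with
    | NU j, NX i => Bs i j
    | NX j, NX i => As i j
    | NX j, NY i => Cs i j
    | NY _, NT => true
    | _, _ => false
    end.

(* No set is a separator when [va = vb] or when there is an edge from [va] to
   [vb], so non-adjacency need not be required separately. *)
Definition vertex_separator (V : finType) (e : rel V) (va vb : V)
    (S : {set V}) : bool :=
  [&& va \notin S, vb \notin S &
      ~~ connect [rel v w | [&& e v w, v \notin S & w \notin S]] va vb].

Definition attacked_states (nx nu m : nat) (As : 'M[bool]_nx)
    (Bs : 'M[bool]_(nx, nu)) (Cs : 'M[bool]_(m, nx))
    (Ua : {set 'I_nu}) (i : 'I_nu) : {set 'I_nx} :=
  [set j | [exists k in Ua :\ i, extended_graph As Bs Cs (NU k) (NX j)]].

(* Main.v *)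
Require Import Defs.
From mathcomp Require Import all_boot all_order all_algebra.
From mathcomp Require Import boolp reals constructive_ereal.

(** Inject an impulse through [u_i] at time 0.  From then on let every other
    attacked actuator cancel whatever would enter the state it drives (it can,
    since distinct actuators drive distinct states), and let every attacked
    sensor subtract its own reading.  The states in [X_a] then stay at 0, so the
    impulse only spreads along paths from [u_i] that avoid the separator; no
    such path reaches [t], hence every sensor outside [Y_a] reads 0 as well. *)

Set Implicit Arguments.
Unset Strict Implicit.
Unset Printing Implicit Defensive.

Import Order.TTheory GRing.Theory Num.Theory.

Local Open Scope ring_scope.

(** Two actuators driving the same state would give two equal columns, which full column rank rules
    out: the transpose is row-free, so multiplication by it separates the basis vectors of [j1] and
    [j2]. *)
Lemma structural_model_driven (R : realType) (nx nu ny ne : nat)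
    (Bs : 'M[bool]_(nx, nu)) (Cs : 'M[bool]_(ny + ne, nx)) :
  structural_model R Bs Cs ->
  exists2 b : 'I_nu -> 'I_nx, injective b & forall x j, Bs x j = (x == b j).
Proof.
case=> [[b colB] rankB _]; exists b => [j1 j2 eq_b | x j].
  have free : row_free (mx01 R Bs)^T by rewrite /row_free mxrank_tr rankB.
  have : delta_mx ord0 j1 = delta_mx ord0 j2 :> 'rV[R]_nu.
    by apply: (row_free_injr free); rewrite /= -!rowE -!tr_col !colB eq_b.
  move=> /rowP /(_ j1); rewrite !mxE !eqxx /=.
  by case: eqP => //= _ /eqP; rewrite oner_eq0.
have /colP /(_ x) := colB j; rewrite !mxE eqxx andbT => /eqP.
by rewrite eqr_nat; case: (Bs x j); case: (x == b j).
Qed.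

Section Attack.
Variables (R : realType) (nx nu ny ne : nat).
Variables (A : 'M[R]_nx) (B : 'M[R]_(nx, nu)) (C : 'M[R]_(ny + ne, nx)).

Lemma security_index_le (i : 'I_nu) (a : attack_signal R nu ny) (n : nat) :
  undetectable_using A B C i a -> (attack_norm0 a <= n)%N ->
  (security_index A B C i <= n%:R%:E)%E.
Proof.
move=> a_ok le_n; have a_size : attack_size A B C i (attack_norm0 a).
  by apply/asboolP; exists a.
rewrite /security_index; case: pselect => [ex_s | []].
  case: ex_minnP => m _ /(_ _ a_size) le_m.
  by rewrite lee_fin ler_nat (leq_trans le_m).
by exists (attack_norm0 a).
Qed.

Lemma output_lshift (a : attack_signal R nu ny) k y :
  output A B C a k (lshift ne y) ord0 =
    (C *m state A B a k) (lshift ne y) ord0 + a k (rshift nu y) ord0.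
Proof.
rewrite /output /attack_output_mx -[in LHS](vsubmxK (a k)) mul_block_col.
by rewrite !mul0mx add0r mul1mx addr0 [LHS]mxE col_mxEu [dsubmx _ _ _]mxE.
Qed.

Lemma output_rshift (a : attack_signal R nu ny) k y :
  output A B C a k (rshift ny y) ord0 = (C *m state A B a k) (rshift ny y) ord0.
Proof.
rewrite /output /attack_output_mx -[in LHS](vsubmxK (a k)) mul_block_col.
by rewrite !mul0mx !addr0 [LHS]mxE col_mxEd [in X in _ + X]mxE addr0.
Qed.

Variables (Xa : {set 'I_nx}) (i : 'I_nu).

(** The trajectory the attack is meant to produce. It is defined without mentioning the attack, so
    that the attack can be read off from it without circularity. *)
Fixpoint cancelled_state (k : nat) : 'cV[R]_nx :=
  if k is k'.+1 then
    \col_x (if x \in Xa then 0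
            else (A *m cancelled_state k') x ord0 + B x i * (k' == 0)%:R)
  else 0.

Variables (b : 'I_nu -> 'I_nx) (Ua : {set 'I_nu}) (Ya : {set 'I_(ny + ne)}).

(** The test [j == i] comes first because [i] itself lies in [Ua]. The divisor is the one nonzero
    entry of column [j] of [B]. *)
Definition actuator_attack (k : nat) : 'cV[R]_nu :=
  \col_j (if j == i then (k == 0)%:R
          else if j \in Ua then - (A *m cancelled_state k) (b j) ord0 / B (b j) j
          else 0).

Definition cancelling_attack : attack_signal R nu ny := fun k =>
  col_mx (actuator_attack k)
    (\col_y (if lshift ne y \in Ya
             then - (C *m cancelled_state k) (lshift ne y) ord0 else 0)).

Lemma cancelling_attack_norm0 :
  i \in Ua -> (attack_norm0 cancelling_attack <= #|Ua| + #|Ya|)%N.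
Proof.
move=> Ua_i; pose Y' := [set y : 'I_ny | lshift ne y \in Ya].
have le_Y : (#|Y'| <= #|Ya|)%N.
  rewrite -(card_imset _ (@lshift_inj ny ne)); apply: subset_leq_card.
  by apply/subsetP => _ /imsetP[y + ->]; rewrite inE.
apply: (@leq_trans #|(@lshift nu ny @: Ua) :|: (@rshift nu ny @: Y')|).
  apply: subset_leq_card; apply/subsetP => j; rewrite !inE => /asboolP[k].
  case: (split_ordP j) => l ->.
    rewrite col_mxEu mxE => a_neq0; rewrite imset_f //.
    by move: a_neq0; case: (eqVneq l i) => [-> //|_]; case: ifP; rewrite ?eqxx.
  rewrite col_mxEd mxE => a_neq0; rewrite orbC imset_f // inE.
  by move: a_neq0; case: ifP; rewrite ?eqxx.
apply: leq_trans (leq_card_setU _ _) _.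
by rewrite !card_imset ?leq_add2l //; [exact: lshift_inj | exact: rshift_inj].
Qed.

(** At most one actuator drives each state, so the input to a state reduces to a single term: the
    cancelling one on [Xa], that of [u_i] elsewhere. *)
Lemma state_cancelling_attack k :
    injective b -> (forall x j, (B x j != 0) = (x == b j)) ->
    (forall x, x \in Xa = [exists j in Ua :\ i, x == b j]) ->
  state A B cancelling_attack k = cancelled_state k.
Proof.
move=> b_inj B_neq0 Xa_b; elim: k => //= k ->.
rewrite /attack_input_mx mul_row_col mul0mx addr0; apply/colP => x.
have B0 j : x != b j -> B x j = 0 by rewrite -B_neq0 negbK => /eqP.
rewrite [LHS]mxE [RHS]mxE [in X in _ + X]mxE Xa_b.
case: ifPn => [/exists_inP[j] | /exists_inPn x_free].
  rewrite in_setD1 => /andP[j_i Ua_j] /eqP x_bj.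
  rewrite (bigD1 j) //= big1 => [|l l_j]; last first.
    by rewrite B0 ?mul0r // x_bj (inj_eq b_inj) eq_sym.
  rewrite [actuator_attack _ _ _]mxE (negPf j_i) Ua_j x_bj addr0.
  by rewrite mulrC divfK ?addrN // B_neq0.
(* Outside [Xa], an actuator other than [u_i] is either idle or drives a different state. *)
rewrite (bigD1 i) //= big1 => [|j j_i].
  by rewrite [actuator_attack _ _ _]mxE eqxx addr0.
rewrite [actuator_attack _ _ _]mxE (negPf j_i).
case: ifP => [Ua_j|]; last by rewrite mulr0.
by rewrite B0 ?mul0r // x_free // in_setD1 j_i.
Qed.

(** By induction on time: a nonzero entry comes either from the impulse, through an edge leaving
    [u], or from a nonzero entry one step earlier, which extends a path already found. Entries in
    [Xa] are 0, so the path avoids [Xa]. *)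
Lemma cancelled_state_connect (V : finType) (e : rel V) (v : 'I_nx -> V) u k x :
    (forall x, x \notin Xa -> B x i != 0 -> e u (v x)) ->
    (forall x x', x \notin Xa -> x' \notin Xa -> A x x' != 0 -> e (v x') (v x)) ->
  cancelled_state k x ord0 != 0 -> (x \notin Xa) && connect e u (v x).
Proof.
move=> e_u e_v; elim: k x => [|k IHk] x; first by rewrite mxE eqxx.
rewrite /= mxE; case: ifPn => [|Xa'x]; first by rewrite eqxx.
case: (eqVneq (B x i) 0) => [->|Bxi _]; last by rewrite connect1 // e_u.
rewrite mul0r addr0 mxE => sum_neq0.
have [x' ] : exists x', A x x' * cancelled_state k x' ord0 != 0.
  apply/existsP; apply: contraNT sum_neq0; rewrite negb_exists => /forallP all0.
  by rewrite big1 // => x' _; apply/eqP; rewrite -[_ == _]negbK.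
rewrite mulf_eq0 negb_or => /andP[Axx' /IHk /andP[Xa'x' con]].
by rewrite (connect_trans con) // connect1 // e_v.
Qed.

End Attack.

Theorem theorem2 (R : realType) (nx nu ny ne : nat)
    (As : 'M[bool]_nx) (Bs : 'M[bool]_(nx, nu)) (Cs : 'M[bool]_(ny + ne, nx))
    (hstruct : structural_model R Bs Cs)
    (Ua : {set 'I_nu}) (Ya : {set 'I_(ny + ne)})
    (hYa : forall y, y \in Ya -> (y < ny)%N)
    (i : 'I_nu) (hi : i \in Ua)
    (hsep : vertex_separator (extended_graph As Bs Cs) (NU i) NT
              ([set NX x | x in attacked_states As Bs Cs Ua i]
                 :|: [set NY y | y in Ya]))
    (A : 'M[R]_nx) (B : 'M[R]_(nx, nu)) (C : 'M[R]_(ny + ne, nx))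
    (hreal : realization As Bs Cs A B C) :
  (security_index A B C i <= (#|Ua| + #|Ya|)%:R%:E)%E.
Proof.
have [b b_inj BsE] := structural_model_driven hstruct.
have [hA hB hC hBs] := hreal.
set Xa := attacked_states As Bs Cs Ua i in hsep.
set S := _ :|: _ in hsep.
have S_NX x : (NX x \in S) = (x \in Xa).
  by rewrite inE mem_imset => [|? ? [] //]; rewrite orb_idr // => /imsetP[].
have S_NY y : (NY y \in S) = (y \in Ya).
  by rewrite inE orbC mem_imset => [|? ? [] //]; rewrite orb_idr // => /imsetP[].
(* Entries of [B] vanish exactly where the structure does; for [A] and [C] only the direction from a
   nonzero entry to an edge holds. *)
have B_neq0 x j : (B x j != 0) = (x == b j).
  rewrite -BsE; apply/idP/idP => [|/hBs //]; apply: contraNT => /negbTE.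
  by move/hB=> ->.
have Xa_b x : x \in Xa = [exists j in Ua :\ i, x == b j].
  by rewrite inE; apply: eq_existsb => j; rewrite /= BsE.
have stateE k := state_cancelling_attack A C Ya k b_inj B_neq0 Xa_b.
have [S'u S't /negP not_con] := and3P hsep.
set e := [rel v w | _] in not_con.
have C_state k y : y \notin Ya -> (C *m cancelled_state A B Xa i k) y ord0 = 0.
  move=> Ya'y; rewrite mxE big1 // => x _; apply/eqP; apply: contraT.
  rewrite mulf_eq0 negb_or => /andP[Cyx z_x].
  have /andP[Xa'x con] : (x \notin Xa) && connect e (NU i) (NX x).
    apply: cancelled_state_connect z_x => [x' Xa'x' | x' x'' Xa'x' Xa'x''] M_neq0.
      by rewrite /e /= S'u S_NX Xa'x' BsE -B_neq0 M_neq0.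
    rewrite /e /= !S_NX Xa'x' Xa'x'' !andbT.
    by apply: contraNT M_neq0 => /negbTE /hA ->.
  (* The path from [u_i] to [x] continues through [y] to [t] and still avoids the separator, a
     contradiction. *)
  case: not_con; apply: (connect_trans con).
  apply: (@connect_trans _ _ (NY y)); apply: connect1;
    rewrite /e /= S_NY Ya'y ?S't //.
  rewrite S_NX Xa'x !andbT.
  by apply: contraNT Cyx => /negbTE /hC ->.
pose a := cancelling_attack A B C Xa i b Ua Ya.
apply: (@security_index_le _ _ _ _ _ _ _ _ _ a).
  split; last first.
    (* The impulse makes [u_i] active at time 0. *)
    by exists 0; rewrite col_mxEu mxE eqxx oner_eq0.
  move=> k; apply/colP => y; rewrite [RHS]mxE; case: (split_ordP y) => l ->.
    rewrite output_lshift stateE col_mxEd [X in _ + X]mxE.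
    by case: ifPn => [_ | /C_state ->]; rewrite ?addrN ?addr0.
  rewrite output_rshift stateE C_state //.
  (* A protected sensor has index at least [ny], so it is not in [Ya]. *)
  by apply/negP => /hYa; rewrite ltnNge leq_addr.
exact: cancelling_attack_norm0.
Qed.
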